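(* There is a function $g_0(t)$ depending only on $t$, with $g_0(t)\ge(2^{20}t^6)^{20t}$, such that the following holds. Let $s,t,n,k$ be positive integers with $n\ge k^{20t}$, $n\ge s^{40t}\cdot g_0(t)$ and $k\ge 5t$. Let $\mathcal{F}\subset\binom{[n]}{k}$ be a family containing no sunflower with $s$ petals whose core has size exactly $t-1$. Then $$|\mathcal{F}|\le\phi(s,t)\binom{n-t}{k-t}+n^{-1/3}\binom{n-t}{k-t}.$$
   Context: A sunflower with $s$ petals is a family of $s$ distinct sets $F_1,\dots,F_s$ with $F_i\cap F_j=\bigcap_uF_u$ for all distinct $i,j$; the set $\bigcap_uF_u$ is its core. $\phi(s,t)$ is the maximum size of a $t$-uniform family containing no sunflower with $s$ petals (arbitrary core).
   Formalization: The formal theorem requires s ≥ 2 rather than s ≥ 1: for s = 1 one has φ(1,t) = 0 while the family of all k-subsets of [n] contains no one-petal sunflower with core of size t−1, so the stated bound fails. *)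

(* Defs.v *)
From mathcomp Require Import all_boot all_order all_algebra.
From mathcomp Require Import boolp reals exp.
From mathcomp Require classical_sets.

Set Implicit Arguments.
Unset Strict Implicit.
Unset Printing Implicit Defensive.

Definition uniform (T : finType) (t : nat) (F : {set {set T}}) : Prop :=
  forall A, A \in F -> #|A| = t.

Definition core (T : finType) (S : {set {set T}}) : {set T} :=
  \bigcap_(A in S) A.

(* With S a set of sets, the petals are automatically distinct. For s = 1 the
   core is the only petal, so phi 1 t = 0 while a k-uniform family with
   k > t - 1 contains no 1-petal sunflower with core of size t - 1: the bound
   on families with a forbidden core size is therefore only meaningful for
   s >= 2. *)
Definition sunflower (T : finType) (s : nat) (S : {set {set T}}) : Prop :=
  #|S| = s /\
  forall A B, A \in S -> B \in S -> A != B -> A :&: B = core S.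

Definition sunflower_free (T : finType) (s : nat) (F : {set {set T}}) : Prop :=
  ~ exists S : {set {set T}}, S \subset F /\ sunflower s S.

Definition sunflower_free_core (T : finType) (s c : nat)
    (F : {set {set T}}) : Prop :=
  ~ exists S : {set {set T}},
      [/\ S \subset F, sunflower s S & #|core S| = c].

(* The ground set of the family is an arbitrary finite set. *)
Definition sunflower_free_size (s t m : nat) : Prop :=
  exists (N : nat) (F : {set {set 'I_N}}),
    [/\ uniform t F, sunflower_free s F & #|F| = m].

Definition is_phi (s t m : nat) : Prop :=
  sunflower_free_size s t m /\
  forall m', sunflower_free_size s t m' -> m' <= m.

(* The maximum exists for every s > 0, by the Erdos-Rado bound: see phiP. The
   default value 0 is only reached for s = 0, where no family is
   sunflower-free. *)
Definition phi (s t : nat) : nat := classical_sets.xget 0 (is_phi s t).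

Lemma erdos_rado (T : finType) (s t : nat) (F : {set {set T}}) :
  0 < s -> uniform t F -> sunflower_free s F -> #|F| <= t`! * s.-1 ^ t.
Proof.
move=> s0; elim: t F => [|t IH] F uF fF.
  rewrite fact0 expn0 mul1n -(cards1 (@set0 T)); apply: subset_leq_card.
  by apply/subsetP => A /uF /eqP; rewrite cards_eq0 inE.
pose dj (M : {set {set T}}) := (M \subset F) &&
  [forall A in M, forall B in M, (A != B) ==> [disjoint A & B]].
have dj0 : dj set0.
  by rewrite /dj sub0set; apply/forall_inP => A; rewrite inE.
case: (arg_maxnP (fun M : {set {set T}} => #|M|) dj0) => M djM maxM.
have [MF Md] := andP djM.
have {}Md A B : A \in M -> B \in M -> A != B -> A :&: B = set0.
  move=> AM BM AB; apply: disjoint_setI0.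
  by move/forall_inP/(_ A AM)/forall_inP/(_ B BM)/implyP: Md; apply.
have Ms : #|M| <= s.-1.
  rewrite -ltnS prednK // ltnNge; apply/negP => sM; apply: fF.
  have [S /andP[SM /eqP Sc]] : exists S : {set {set T}}, (S \subset M) && (#|S| == s).
    have : 0 < #|[set S : {set {set T}} | S \subset M & #|S| == s]|.
      by rewrite cards_draws bin_gt0.
    rewrite card_gt0 => /set0Pn[S]; rewrite inE => ?; by exists S.
  exists S; split; first exact: subset_trans SM MF.
  split=> // A B AS BS AB.
  have AB0 := Md A B (subsetP SM _ AS) (subsetP SM _ BS) AB.
  rewrite AB0; apply/esym/eqP; rewrite -subset0 -AB0 subsetI.
  by rewrite !bigcap_inf.
pose Y := cover M.
have Yc : #|Y| <= s.-1 * t.+1.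
  apply: (@leq_trans (\sum_(A in M) #|A|)); first exact: leq_card_cover.
  rewrite (eq_bigr (fun=> t.+1)) => [|A AM]; last by rewrite uF // (subsetP MF).
  by rewrite sum_nat_const leq_mul2r Ms orbT.
have meetY A : A \in F -> exists2 x, x \in Y & x \in A.
  move=> AF; apply/exists_inP; rewrite -[X in is_true X]negbK negb_exists_in.
  apply/negP => /forall_inP H.
  have AY : A :&: Y = set0.
    apply/setP => x; rewrite !inE; apply/negbTE/negP => /andP[xA xY].
    by move: (H x xY); rewrite xA.
  have ABd B : B \in M -> [disjoint A & B].
    move=> BM; rewrite -setI_eq0 -subset0 -AY; apply: setIS.
    by apply: (bigcup_max B).
  have AnM : A \notin M.
    apply/negP => AM; have := ABd A AM; rewrite -setI_eq0 setIid => /eqP A0.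
    by have := uF A AF; rewrite A0 cards0.
  have /maxM : dj (A |: M).
    apply/andP; split; first by rewrite subUset sub1set AF.
    apply/forall_inP => B /setU1P[->|BM]; apply/forall_inP => C /setU1P[->|CM];
      apply/implyP => BC.
    - by rewrite eqxx in BC.
    - exact: ABd.
    - by rewrite disjoint_sym; apply: ABd.
    - by rewrite -setI_eq0 Md.
  by rewrite cardsU1 AnM /= ltnn.
pose Fx x := [set A in F | x \in A].
have Fxc x : #|Fx x| <= t`! * s.-1 ^ t.
  pose G := [set A :\ x | A in Fx x].
  have injG : {in Fx x &, injective (fun A : {set T} => A :\ x)}.
    move=> A B; rewrite !inE => /andP[_ xA] /andP[_ xB] AB.
    by rewrite -(setD1K xA) AB setD1K.
  rewrite -(card_in_imset injG); apply: IH.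
    move=> _ /imsetP[A + ->]; rewrite inE => /andP[AF xA].
    by have := uF A AF; rewrite (cardsD1 x) xA => -[].
  case=> S [SG [Sc SI]]; apply: fF.
  have Sx B : B \in S -> (x \notin B) /\ (x |: B) \in F.
    move=> /(subsetP SG) /imsetP[A + ->]; rewrite inE => /andP[AF xA].
    by rewrite setD11 setD1K.
  exists [set (x |: B) | B in S]; split.
    by apply/subsetP => _ /imsetP[B /Sx[_ ?] ->].
  split.
    rewrite card_in_imset // => B C /Sx[xB _] /Sx[xC _] BC.
    by rewrite -(setU1K xB) BC setU1K.
  move=> _ _ /imsetP[B BS ->] /imsetP[C CS ->] BC.
  have nBC : B != C by apply: contraNneq BC => ->.
  rewrite -setUIr SI //; apply/setP => y; rewrite /core; apply/idP/bigcapP.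
    move=> + _ /imsetP[D DS ->]; rewrite !inE => /orP[->//|/bigcapP/(_ _ DS) ->].
    by rewrite orbT.
  move=> H; rewrite !inE; case: eqVneq => //= yx; apply/bigcapP => D DS.
  by have := H _ (imset_f _ DS); rewrite !inE (negbTE yx).
have : #|F| <= \sum_(x in Y) #|Fx x|.
  apply: (@leq_trans #|\bigcup_(x in Y) Fx x|).
    apply/subset_leq_card/subsetP => A AF; have [x xY xA] := meetY A AF.
    by apply/bigcupP; exists x => //; rewrite inE AF.
  apply: (big_rec2 (fun (A : {set {set T}}) n => #|A| <= n)).
    by rewrite cards0.
  move=> x n A _ An; apply: leq_trans (leq_card_setU _ _) _.
  by rewrite leq_add2l.
move=> /leq_trans; apply.
apply: (@leq_trans (#|Y| * (t`! * s.-1 ^ t))).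
  by rewrite -sum_nat_const; apply: leq_sum => x _; exact: Fxc.
apply: leq_trans (leq_mul Yc (leqnn _)) _.
by rewrite factS expnS [s.-1 * t.+1]mulnC mulnACA.
Qed.

Lemma phiP (s t : nat) : 0 < s -> is_phi s t (phi s t).
Proof.
move=> s0; suff : exists m, is_phi s t m by case=> m; exact: classical_sets.xgetI.
pose P m := `[< sunflower_free_size s t m >].
have exP : exists m, P m.
  exists 0; apply/asboolP; exists 0, set0; split; rewrite ?cards0 //.
    by move=> A; rewrite inE.
  case=> S [+ [Sc _]]; rewrite subset0 => /eqP S0.
  by rewrite -Sc S0 cards0 in s0.
have ubP m : P m -> m <= t`! * s.-1 ^ t.
  by move=> /asboolP[N [F [uF fF <-]]]; exact: erdos_rado.
case: (ex_maxnP exP ubP) => m /asboolP Pm maxm; exists m; split=> // m' Pm'.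
exact/maxm/asboolP.
Qed.

(* Main.v *)
(* Call K a kernel of a family F if no small set Y outside K meets all members
   of F containing K. Kernels K_1, ..., K_s with pairwise intersection C extend
   greedily to a sunflower with core C, so F has no kernel of size t - 1.

   Every A in F is given a mark I <= A together with a part N <= I, and kernels
   are only witnessed by sets whose marks agree on the kernel. As long as some A
   has x outside I such that no kernel avoiding x contains A - (I + x), the
   element x is added to the mark I; as long as some b in N belongs to all
   kernels containing a set A - (I + x), it is dropped from N. Sets treated this
   way are removed one at a time, and comparing kernels with the time of removal
   shows that no proper kernel of A contains A - I. Hence a set with |I| = t + 1
   is determined by A - I up to boundedly many choices, and there are only
   O(C(n, k - t - 1)) of those.

   In the families that remain, A - I can be replaced one element at a time by
   elements avoiding any given small Y, which also flushes N out of A. If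
   |I - N| < t this produces a kernel of size t - 1, a contradiction. Otherwise
   |I| = t, N is empty, and all sets between I and A are kernels; then for fixed
   G = A - I the marks I form a t-uniform family without any sunflower with s
   petals, so there are at most phi(s,t) C(n, k - t) such A. *)

Require Import Defs.
From mathcomp Require Import all_boot all_order all_algebra.
From mathcomp Require Import boolp reals exp.
From mathcomp Require Import zify.
Import Order.TTheory GRing.Theory Num.Theory.

Set Implicit Arguments.
Unset Strict Implicit.
Unset Printing Implicit Defensive.

(** * Counting by fibres and unions *)

Lemma card_le_fibers (A U : finType) (E : {set A}) (f : A -> U) (V : {set U})
    (c : nat) :
  (forall a, a \in E -> f a \in V) ->
  (forall u, u \in V -> #|[set a in E | f a == u]| <= c) -> #|E| <= #|V| * c.
Proof.
move=> fV cV; rewrite -sum1_card (partition_big f (mem V)) //= -sum_nat_const.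
apply: leq_sum => u uV; apply: leq_trans (cV u uV); rewrite -sum1_card.
by apply: eq_leq; apply: eq_bigl => a; rewrite inE.
Qed.

Lemma card_bigcup_le (A U : finType) (V : {set U}) (h : U -> {set A}) (c : nat) :
  (forall u, u \in V -> #|h u| <= c) -> #|\bigcup_(u in V) h u| <= #|V| * c.
Proof.
move=> hc; rewrite -sum_nat_const.
apply: (big_rec2 (fun (A : {set A}) n => #|A| <= n)); first by rewrite cards0.
move=> u n B uV Bn; apply: leq_trans (leq_card_setU _ _) _.
by rewrite leq_add ?hc.
Qed.

(** * Marked sets, kernels and removal orders *)

(* A marked set (A, I, N), with N <= I <= A imposed later by [layered]: kernels
   containing A minus I minus a point must contain I minus N. *)
Definition marked_set (T : finType) := ({set T} * {set T} * {set T})%type.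
Definition supp (T : finType) (e : marked_set T) : {set T} := e.1.1.
Definition mark (T : finType) (e : marked_set T) : {set T} := e.1.2.
Definition loose (T : finType) (e : marked_set T) : {set T} := e.2.

Definition agree (T : finType) (K : {set T}) (e e' : marked_set T) : bool :=
  [&& K \subset supp e', mark e' :&: K == mark e :&: K
    & loose e' :&: K == loose e :&: K].

(** [e] enters only through the traces of its mark and loose part on [K]. *)
Definition kernel (T : finType) (L : nat) (E : {set marked_set T}) (K : {set T})
    (e : marked_set T) : Prop :=
  forall Y : {set T}, #|Y| <= L ->
  exists e', [/\ e' \in E, agree K e e' & supp e' :&: Y \subset K].

Lemma kernelS (T : finType) (L L' : nat) (E E' : {set marked_set T}) K e :
  L <= L' -> E \subset E' -> kernel L' E K e -> kernel L E' K e.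
Proof.
move=> LL /subsetP EE kK Y YL; have [e' [e'E ag s]] := kK Y (leq_trans YL LL).
by exists e'; split=> //; exact: EE.
Qed.

(** If every class [f a = v] could be hit outside [K] by at most [L] points, the union of these
    hitting sets over [V] would hit every [a]. *)
Lemma unhittable_pigeonhole (T A U : finType) (P : A -> Prop) (g : A -> {set T})
    (f : A -> U) (V : {set U}) (K : {set T}) (L : nat) :
  (forall a, P a -> f a \in V) ->
  (forall Y : {set T}, #|Y| <= #|V| * L ->
     exists2 a, P a & g a :&: Y \subset K) ->
  exists v, forall Y : {set T}, #|Y| <= L ->
    exists a, [/\ P a, f a = v & g a :&: Y \subset K].
Proof.
move=> fV H; apply: contrapT => nex.
have /choice[h hP] : forall v, exists Y : {set T}, #|Y| <= L /\
    forall a, P a -> f a = v -> ~~ (g a :&: Y \subset K).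
  move=> v; apply: contrapT => nY; apply: nex; exists v => Y YL.
  apply: contrapT => na; apply: nY; exists Y; split=> // a Pa fa.
  by apply/negP => s; apply: na; exists a.
have [|a Pa s] := H (\bigcup_(v in V) h v).
  by apply: card_bigcup_le => v _; case: (hP v).
have [_ /(_ a Pa erefl)/negP] := hP (f a); apply; apply: subset_trans s.
by apply: setIS; apply: bigcup_sup; exact: fV.
Qed.

(** Bad elements are removed one at a time until none is left. [r] is the time of removal, so the
    displayed union is the family still present when [a] goes; [w a] records why [a] was bad
    then. *)
Lemma peeling_order (A W : finType) (w0 : W) (bad : {set A} -> A -> W -> Prop)
    (E : {set A}) :
  exists (S : {set A}) (r : A -> nat) (w : A -> W),
  [/\ S \subset E, forall a v, a \in S -> ~ bad S a v &
      forall a, a \in E -> a \notin S ->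
        bad (S :|: [set b in E :\: S | r a <= r b]) a (w a)].
Proof.
move: {2}#|E| (leqnn #|E|) => n; elim: n E => [|n IH] E En.
  exists E, (fun=> 0), (fun=> w0); split=> // [a v|a] aE; last by rewrite aE.
  by move: En; rewrite leqn0 cards_eq0 => /eqP E0; rewrite E0 inE in aE.
have [[a [v [aE bav]]]|nbad] := pselect (exists a v, a \in E /\ bad E a v);
  last first.
  exists E, (fun=> 0), (fun=> w0); split=> // [a v aE bav|a aE]; last by rewrite aE.
  by apply: nbad; exists a, v.
have [|S [r [w [SE stS rS]]]] := IH (E :\ a).
  by move: En; rewrite (cardsD1 a) aE.
have aS : a \notin S by apply/negP => /(subsetP SE); rewrite !inE eqxx.
(* The element removed now gets time 0; all other removals are delayed by one. *)
exists S, (fun b => if b == a then 0 else (r b).+1),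
  (fun b => if b == a then v else w b); split=> //.
  exact: subset_trans SE (subsetDl _ _).
move=> b bE bS; case: eqVneq => [->|ba].
  suff -> : S :|: [set b in E :\: S | 0 <= if b == a then 0 else (r b).+1] = E.
    by [].
  apply/setP => c; rewrite !inE andbT.
  by case: (boolP (c \in S)) => //= /(subsetP SE); rewrite !inE => /andP[_ ->].
have := rS b; rewrite !inE ba bE => /(_ isT bS); congr (bad _ b _).
apply/setP => c; rewrite !inE; case: eqVneq => [->|_] /=; last by rewrite ltnS.
by rewrite !andbF.
Qed.

(** * Exchanging elements inside a stable family *)

(** Each kernel trades the current set for one avoiding [Y] outside the kernel. Flushing a loose
    element costs at most one element of [C1], so [C1] needs [#|loose e0|] spare elements beyond
    [c0]. *)
Lemma stable_flush (T : finType) (L : nat) (S : {set marked_set T})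
    (e0 : marked_set T) (C1 Y : {set T}) (c0 : nat) :
  (forall e, e \in S -> loose e \subset mark e /\ mark e \subset supp e) ->
  (forall e x, e \in S -> x \in supp e -> x \notin mark e ->
     exists K : {set T}, [/\ K \subset supp e, kernel L S K e, x \notin K
                 & supp e :\: K \subset x |: loose e]) ->
  (forall e b, e \in S -> b \in loose e ->
     exists (K : {set T}) x, [/\ K \subset supp e, kernel L S K e, b \notin K, x \notin mark e
                 & supp e :\: K \subset x |: loose e]) ->
  e0 \in S -> C1 \subset supp e0 -> [disjoint C1 & mark e0] ->
  #|loose e0| + c0 <= #|C1| -> #|Y| <= L ->
  exists e (C : {set T}), [/\ e \in S, C \subset supp e, supp e :&: Y \subset C
    & [/\ mark e0 :\: loose e0 \subset C, C \subset C1 :|: (mark e0 :\: loose e0)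
        & #|C :&: C1| = c0]].
Proof.
move=> nest hA hB e0S C1s dC1 C1c YL.
(* [C] is the part of [e0] kept so far. The last premise is the budget: [C1] can still pay one
   element for each loose element left in [C]. *)
suff H n e (C : {set T}) : #|C| < n -> e \in S -> C \subset supp e ->
    C \subset supp e0 ->
    mark e :&: C = mark e0 :&: C -> loose e :&: C = loose e0 :&: C ->
    mark e0 :\: loose e0 \subset C -> supp e :&: Y \subset C ->
    #|loose e0 :&: C| + c0 <= #|C :&: C1| ->
    exists e (C : {set T}), [/\ e \in S, C \subset supp e, supp e :&: Y \subset C
      & [/\ mark e0 :\: loose e0 \subset C,
            C \subset C1 :|: (mark e0 :\: loose e0) & #|C :&: C1| = c0]].
  have [sr rs] := nest _ e0S.
  apply: (H #|supp e0|.+1 e0 (supp e0)) => //; first exact: subset_trans (subsetDl _ _) rs.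
    exact: subsetIl.
  by rewrite (setIidPl (subset_trans sr rs)) (setIidPr C1s).
elim: n e C => // n IH e C Cn eS Ce C0 rC sC fC YC numC.
have inr z : z \in C -> (z \in mark e) = (z \in mark e0).
  by move=> zC; have /setP/(_ z) := rC; rewrite !inE zC !andbT.
have ins z : z \in C -> (z \in loose e) = (z \in loose e0).
  by move=> zC; have /setP/(_ z) := sC; rewrite !inE zC !andbT.
have [sr0 rs0] := nest _ e0S.
(* One exchange replaces [C] by [C :&: K]. At most [x] is lost from [C1]; the last premise says that
   nothing is lost there, or a loose element leaves too, or the budget has slack. *)
have step (K : {set T}) x z : K \subset supp e -> kernel L S K e -> x \notin mark e ->
    supp e :\: K \subset x |: loose e -> z \in C -> z \notin K ->
    [|| x \notin C1, #|loose e0 :&: (C :&: K)| < #|loose e0 :&: C|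
      | #|loose e0 :&: C| + c0 < #|C :&: C1|] ->
    exists e (C : {set T}), [/\ e \in S, C \subset supp e, supp e :&: Y \subset C
      & [/\ mark e0 :\: loose e0 \subset C,
            C \subset C1 :|: (mark e0 :\: loose e0) & #|C :&: C1| = c0]].
  move=> Ke kK xr /subsetP dK zC zK num.
  have rem y : y \in C -> y \notin K -> y = x \/ y \in loose e0.
    move=> yC yK; have := dK y; rewrite !inE yK (subsetP Ce _ yC) => /(_ isT).
    by rewrite ins // => /orP[/eqP|]; [left|right].
  have [e' [e'S /and3P[Ke' /eqP rK /eqP sK] YK]] := kK Y YL.
  apply: (IH e' (C :&: K)) => //.
  - rewrite -ltnS; apply: leq_trans Cn; rewrite ltnS; apply: proper_card.
    by apply/properP; split; [exact: subsetIl|exists z; rewrite // !inE zC].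
  - exact: subset_trans (subsetIr _ _) Ke'.
  - exact: subset_trans (subsetIl _ _) C0.
  - by rewrite (setIC C) !setIA rK -!setIA (setIC K) !setIA rC.
  - by rewrite (setIC C) !setIA sK -!setIA (setIC K) !setIA sC.
  - apply/subsetP => y yf; have yC := subsetP fC _ yf; rewrite inE yC /=.
    move: yf; rewrite inE => /andP[ys yr]; apply: contraT => yK.
    have [yx|] := rem y yC yK; last by rewrite (negbTE ys).
    by move: xr; rewrite -yx inr // yr.
  - apply/subsetP => y yY; have yK := subsetP YK _ yY; rewrite inE yK andbT.
    apply: (subsetP YC); rewrite inE (subsetP Ke _ yK).
    by move: yY; rewrite inE => /andP[].
  have le1 : #|loose e0 :&: (C :&: K)| <= #|loose e0 :&: C|.
    by apply: subset_leq_card; apply: setIS; apply: subsetIl.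
  have remC1 y : y \in C -> y \in C1 -> y \notin K -> y = x.
    move=> yC yC1 yK; have [//|ys] := rem y yC yK.
    have := disjointFr dC1 yC1; by rewrite (subsetP sr0 _ ys).
  have le2 : #|C :&: C1| <= (x \in C1) + #|C :&: K :&: C1|.
    case: (boolP (x \in C1)) => xC1.
      apply: leq_trans (_ : #|x |: (C :&: K :&: C1)| <= _); last first.
        by rewrite cardsU1; case: (_ \notin _).
      apply/subset_leq_card/subsetP => y; rewrite !inE => /andP[yC yC1].
      rewrite yC yC1 andbT /=; case: (boolP (y \in K)); first by rewrite orbT.
      by move=> yK; rewrite (remC1 y) ?eqxx.
    apply/subset_leq_card/subsetP => y; rewrite !inE => /andP[yC yC1].
    rewrite yC yC1 andbT /=; apply: contraT => yK.
    by rewrite -(remC1 y) // yC1 in xC1.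
  have arith (d a a' c c' : nat) (b : bool) :
      [|| ~~ b, a' < a | a + d < c] -> a' <= a -> c <= b + c' -> a + d <= c ->
      a' + d <= c' by clear; case: b => /=; lia.
  exact: arith num le1 le2 numC.
(* Order of the exchanges: first elements outside [C1] and the mark, then loose ones, finally the
   surplus of [C1] over [c0]. *)
have [|[x]] := set_0Vmem (C :\: (C1 :|: mark e0)); last first.
  rewrite !inE negb_or => /andP[/andP[xC1 xr] xC].
  have [||K [Ke kK xK dK]] := hA e x eS; first exact: (subsetP Ce).
    by rewrite inr.
  by apply: (step K x x); rewrite ?xC1 // inr.
move=> /eqP; rewrite setD_eq0 => Csub.
have [loose0|[b]] := set_0Vmem (loose e0 :&: C); last first.
  rewrite inE => /andP[bs bC].
  have [|K [x [Ke kK bK xr dK]]] := hB e b eS; first by rewrite ins.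
  apply: (step K x b) => //; apply/orP; right; apply/orP; left.
  apply: proper_card; apply/properP; split; first exact: setIS (subsetIl _ _).
  by exists b; rewrite !inE bs bC // (negbTE bK).
have [numC'|] := leqP #|C :&: C1| c0; last first.
  move=> lt; have : 0 < #|C :&: C1| by apply: leq_ltn_trans lt.
  rewrite card_gt0 => /set0Pn[x]; rewrite inE => /andP[xC xC1].
  have xr : x \notin mark e by rewrite inr // (disjointFr dC1 xC1).
  have [|K [Ke kK xK dK]] := hA e x eS _ xr; first exact: (subsetP Ce).
  by apply: (step K x x) => //; rewrite loose0 cards0 lt !orbT.
exists e, C; split=> //; split=> //; last first.
  by apply/eqP; rewrite eqn_leq numC'; move: numC; rewrite loose0 cards0.
apply/subsetP => y yC; have := subsetP Csub _ yC; rewrite !inE.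
case/orP=> [->//|yr]; apply/orP; right; rewrite yr andbT.
by apply/negP => ys; have := in_set0 y; rewrite -loose0 inE ys yC.
Qed.

(** * Relabelling marked families *)

Definition layered (T : finType) (k m v : nat) (E : {set marked_set T}) : Prop :=
  forall e, e \in E -> [/\ mark e \subset supp e, loose e \subset mark e,
    #|supp e| = k, #|mark e| = m & #|loose e| = v].

Definition indep (T : finType) (L : nat) (E : {set marked_set T}) : Prop :=
  forall e (K : {set T}), e \in E -> K \subset supp e -> kernel L E K e ->
    supp e :\: K \subset mark e -> K = supp e.

Definition rigid (T : finType) (L : nat) (E : {set marked_set T}) : Prop :=
  forall e x (K : {set T}), e \in E -> x \in supp e -> x \notin mark e ->
    K \subset supp e -> kernel L E K e ->
    supp e :\: K \subset x |: mark e -> supp e :\: K \subset x |: loose e.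

(** The loose part restarts as the whole new mark, which makes rigidity of the relabelled family
    automatic by [rigid_loose_mark]. *)
Definition stuck (T : finType) (L : nat) (E : {set marked_set T})
    (e e' : marked_set T) : Prop :=
  exists x, [/\ x \in supp e, x \notin mark e,
    e' = (supp e, x |: mark e, x |: mark e) &
    forall K : {set T}, K \subset supp e -> kernel L E K e ->
      supp e :\: K \subset x |: mark e -> x \in K].

Definition hardening (T : finType) (L : nat) (E : {set marked_set T})
    (e e' : marked_set T) : Prop :=
  exists b, [/\ b \in loose e, e' = (supp e, mark e, loose e :\ b) &
    forall (K : {set T}) x, K \subset supp e -> x \in supp e ->
      x \notin mark e -> kernel L E K e ->
      supp e :\: K \subset x |: mark e -> b \in K].

Lemma layered_agree (T : finType) (k m v : nat) (E : {set marked_set T})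
    (K : {set T}) e e' :
  layered k m v E -> e \in E -> e' \in E -> K \subset supp e -> agree K e e' ->
  [/\ #|supp e' :\: K| = #|supp e :\: K|, #|mark e' :\: K| = #|mark e :\: K|
    & #|loose e' :\: K| = #|loose e :\: K|].
Proof.
move=> lE eE e'E Ke /and3P[Ke' /eqP sK /eqP lK].
have [_ _ s1 s2 s3] := lE _ eE; have [_ _ s1' s2' s3'] := lE _ e'E.
by rewrite !cardsD sK lK s1 s2 s3 s1' s2' s3' (setIidPr Ke) (setIidPr Ke').
Qed.

Lemma rigid_loose_mark (T : finType) (k m L : nat) (E : {set marked_set T}) :
  layered k m m E -> rigid L E.
Proof.
move=> lE e x K eE _ _ _ _.
have [_ ls _ cs cl] := lE _ eE.
suff -> : loose e = mark e by [].
by apply/eqP; rewrite eqEcard ls cs cl leqnn.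
Qed.

(* The witnesses of K split into at most 4 ^ m classes by their old marks on K;
   e1 is the first set removed in a class that no small set hits. *)
Lemma relabel_kernel (T : finType) (m L : nat) (R : {set marked_set T})
    (r : marked_set T -> nat) (cur : marked_set T -> {set marked_set T})
    (w : marked_set T -> marked_set T)
    (e' : marked_set T) (K : {set T}) :
  (forall e, e \in R -> [/\ supp (w e) = supp e, mark e \subset mark (w e)
                          & loose e \subset mark (w e)]) ->
  (forall e1 e2, e1 \in R -> e2 \in R -> r e1 <= r e2 -> e2 \in cur e1) ->
  #|mark e'| <= m -> kernel (4 ^ m * L) (w @: R) K e' ->
  exists e1, [/\ e1 \in R, agree K e' (w e1) & kernel L (cur e1) K e1].
Proof.
move=> wR curR cm kK.
pose V := setX (powerset (mark e' :&: K)) (powerset (mark e' :&: K)).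
pose P (a : marked_set T) := (a \in R) && agree K e' (w a).
pose f (a : marked_set T) := (mark a :&: K, loose a :&: K).
have [|Y YL|v vP] := @unhittable_pigeonhole T (marked_set T) _ P (@supp T) f V K L.
- move=> a /andP[aR /and3P[_ /eqP st _]]; have [_ s1 s2] := wR _ aR.
  by rewrite !inE -st !setSI.
- have [|e'' [/imsetP[a aR ->] ag s]] := kK Y.
    apply: leq_trans YL _; rewrite leq_mul2r; apply/orP; right.
    rewrite cardsX !card_powerset -expnD addnn -mul2n -[4]/(2 ^ 2) -expnM leq_exp2l //.
    rewrite leq_mul2l /=; apply: leq_trans cm; exact/subset_leq_card/subsetIl.
  by exists a; [apply/andP|have [<- _ _] := wR _ aR].
pose D a := P a && (f a == v).
have [a0 Da0] : exists a, D a.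
  have [|a [Pa fa _]] := vP set0; first by rewrite cards0.
  by exists a; rewrite /D Pa fa eqxx.
case: (arg_minnP r Da0) => e1 /andP[/andP[e1R ag1] /eqP f1] mine1.
exists e1; split=> // Y YL; have [a [Pa fa s]] := vP Y YL.
have /andP[aR /and3P[Ka _ _]] := Pa.
exists a; split=> //; first by apply: curR => //; apply: mine1; rewrite /D Pa fa eqxx.
have [sa _ _] := wR _ aR; move: f1; rewrite -fa => -[st lo].
by rewrite /agree -sa Ka st lo !eqxx.
Qed.

(** By [relabel_kernel], [K] was a kernel when some [e1] was removed, so stuckness forces [x] into
    [K]. What [K] misses then lies in the old mark, and independence of [E] gives [K = supp e1]. *)
Lemma stuck_indep (T : finType) (k m v L : nat) (E R : {set marked_set T})
    (r : marked_set T -> nat) (cur : marked_set T -> {set marked_set T})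
    (w : marked_set T -> marked_set T) :
  layered k m v E -> indep L E -> R \subset E ->
  (forall e1 e2, e1 \in R -> e2 \in R -> r e1 <= r e2 -> e2 \in cur e1) ->
  (forall e, e \in R -> cur e \subset E) ->
  (forall e, e \in R -> stuck L (cur e) e (w e)) ->
  layered k m.+1 m.+1 (w @: R) /\ indep (4 ^ m.+1 * L) (w @: R).
Proof.
move=> lE iE RE curR curE bR.
have lW : layered k m.+1 m.+1 (w @: R).
  move=> _ /imsetP[e eR ->]; have [x [xs xr -> _]] := bR _ eR.
  have [ss ls cs ct _] := lE _ (subsetP RE _ eR).
  split=> //=; rewrite /mark /loose /supp /= ?cardsU1 ?xr ?ct //.
  by rewrite subUset sub1set xs.
split=> // e' K e'W Ke' kK dK.
have [_ _ cs' ct' _] := lW _ e'W.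
have [||e1 [e1R ag k1]] := @relabel_kernel T m.+1 L R r cur w e' K _ curR _ kK.
- move=> e eR; have [x [_ _ -> _]] := bR _ eR.
  have [_ ls _ _ _] := lE _ (subsetP RE _ eR).
  split=> //; first exact: subsetUr.
  exact: subset_trans ls (subsetUr _ _).
- by rewrite ct'.
have e1W : w e1 \in w @: R by apply: imset_f.
have [c1 c2 _] := layered_agree lW e'W e1W Ke' ag.
have [x [xs xr we bad]] := bR _ e1R.
have e1E := subsetP RE _ e1R.
have [ss _ cs _ _] := lE _ e1E.
have Ke1 : K \subset supp e1 by case/and3P: ag; rewrite we.
(* Agreement transports cardinalities, so outside [K] the new mark of [e1] exhausts its support. *)
have d1 : supp e1 :\: K \subset x |: mark e1.
  have [sw _ _ _ _] := lW _ e1W.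
  have : mark (w e1) :\: K == supp (w e1) :\: K.
    rewrite eqEcard setSD //= c1 c2; apply: subset_leq_card.
    apply/subsetP => y yd; rewrite inE (subsetP dK _ yd) andbT.
    by move: yd; rewrite inE => /andP[].
  by rewrite we => /eqP /= <-; apply: subsetDl.
have xK := bad K Ke1 k1 d1.
have K1 : K = supp e1.
  apply: (iE _ _ e1E Ke1); first exact: kernelS (leqnn _) (curE _ e1R) k1.
  apply/subsetP => y yd; have := subsetP d1 _ yd; rewrite !inE.
  case/orP=> // /eqP yx; by move: yd; rewrite yx inE xK.
by apply/eqP; rewrite eqEcard Ke' cs' K1 cs leqnn.
Qed.

(** Independence survives because the marks are unchanged. For rigidity, if [K] misses a marked
    element of [e'] that is not loose, counting gives one of [w e1] too. It differs from [b], which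
    lies in [K], so it was not loose in [e1] either, against the rigidity of [E]. *)
Lemma hardening_indep (T : finType) (k m v L : nat) (E R : {set marked_set T})
    (r : marked_set T -> nat) (cur : marked_set T -> {set marked_set T})
    (w : marked_set T -> marked_set T) :
  layered k m v E -> indep L E -> rigid L E -> R \subset E ->
  (forall e1 e2, e1 \in R -> e2 \in R -> r e1 <= r e2 -> e2 \in cur e1) ->
  (forall e, e \in R -> cur e \subset E) ->
  (forall e, e \in R -> hardening L (cur e) e (w e)) ->
  [/\ layered k m v.-1 (w @: R), indep (4 ^ m * L) (w @: R)
    & rigid (4 ^ m * L) (w @: R)].
Proof.
move=> lE iE gE RE curR curE bR.
have lW : layered k m v.-1 (w @: R).
  move=> _ /imsetP[e eR ->]; have [b [bl -> _]] := bR _ eR.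
  have [ss ls cs ct cl] := lE _ (subsetP RE _ eR).
  split=> //=; first exact: subset_trans (subsetDl _ _) ls.
  by move: cl; rewrite (cardsD1 b) bl => <-.
have wR e : e \in R -> [/\ supp (w e) = supp e, mark e \subset mark (w e)
                          & loose e \subset mark (w e)].
  move=> eR; have [b [_ -> _]] := bR _ eR.
  by have [_ ls _ _ _] := lE _ (subsetP RE _ eR).
have iW : indep (4 ^ m * L) (w @: R).
  move=> e' K e'W Ke' kK dK; have [_ _ cs' ct' _] := lW _ e'W.
  have [|e1 [e1R ag k1]] := @relabel_kernel T m L R r cur w e' K wR curR _ kK.
    by rewrite ct'.
  have e1W : w e1 \in w @: R by apply: imset_f.
  have [c1 c2 _] := layered_agree lW e'W e1W Ke' ag.
  have [b [bl we _]] := bR _ e1R.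
  have e1E := subsetP RE _ e1R; have [ss _ cs _ _] := lE _ e1E.
  have Ke1 : K \subset supp e1 by case/and3P: ag; rewrite we.
  have K1 : K = supp e1.
    apply: (iE _ _ e1E Ke1); first exact: kernelS (leqnn _) (curE _ e1R) k1.
    move: c1 c2; rewrite we -[supp (_, _, _)]/(supp e1).
    rewrite -[mark (_, _, _)]/(mark e1) => c1 c2.
    have : mark e1 :\: K == supp e1 :\: K.
      rewrite eqEcard setSD //= c1 c2.
      apply: subset_leq_card; apply/subsetP => y yd; rewrite inE (subsetP dK _ yd) andbT.
      by move: yd; rewrite inE => /andP[].
    by move=> /eqP <-; apply: subsetDl.
  by apply/eqP; rewrite eqEcard Ke' cs' K1 cs leqnn.
split=> // e' x K e'W xs xr Ke' kK dK.
have [ss' ls' cs' ct' _] := lW _ e'W.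
have [xK|xK] := boolP (x \in K).
  rewrite (iW _ _ e'W Ke' kK) ?setDv ?sub0set //.
  apply/subsetP => y yd; have := subsetP dK _ yd; rewrite !inE.
  by case/orP=> // /eqP yx; move: yd; rewrite yx inE xK.
apply/subsetP => i idK; rewrite !inE; case: eqVneq => //= ix.
have iS : i \in mark e' by have := subsetP dK _ idK; rewrite !inE (negbTE ix).
have iK : i \notin K by move: idK; rewrite inE => /andP[].
apply: contraT => il.
have [|e1 [e1R ag k1]] := @relabel_kernel T m L R r cur w e' K wR curR _ kK.
  by rewrite ct'.
have e1W : w e1 \in w @: R by apply: imset_f.
have [c1 c2 c3] := layered_agree lW e'W e1W Ke' ag.
have [b [bl we bad]] := bR _ e1R.
have e1E := subsetP RE _ e1R; have [ss1 ls1 cs1 _ _] := lE _ e1E.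
have Ke1 : K \subset supp e1 by case/and3P: ag; rewrite we.
move: c1 c2 c3; rewrite we.
rewrite -[supp (_, _, _)]/(supp e1) -[mark (_, _, _)]/(mark e1).
rewrite -[loose (_, _, _)]/(loose e1 :\ b) => c1 c2 c3.
have lt1 : #|loose e' :\: K| < #|mark e' :\: K|.
  apply: proper_card; apply/properP; split; first exact: setSD.
  by exists i; rewrite !inE iK ?iS // (negbTE il).
have e2 : supp e' :\: K = x |: (mark e' :\: K).
  apply/setP => y; rewrite !inE; apply/idP/idP.
    move=> yd; have := subsetP dK y; rewrite !inE yd => /(_ isT).
    by case/orP=> ->//; case/andP: yd => ->; rewrite orbT.
  by case/orP=> [/eqP ->|/andP[-> /(subsetP ss')]//]; rewrite xK.
have c4 : #|supp e1 :\: K| = #|mark e1 :\: K|.+1.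
  by rewrite c1 e2 cardsU1 !inE (negbTE xr) andbF c2.
(* [x1] is the counterpart of [x]: the only unmarked element of [e1] outside [K]. *)
have : 0 < #|(supp e1 :\: K) :\: (mark e1 :\: K)|.
  by rewrite cardsDS ?setSD // c4 subSnn.
rewrite card_gt0 => /set0Pn[x1]; rewrite !inE => /andP[/nandP x1r /andP[x1K x1s]].
have {}x1r : x1 \notin mark e1 by case: x1r; rewrite ?x1K.
have d1 : supp e1 :\: K \subset x1 |: mark e1.
  have : x1 |: (mark e1 :\: K) == supp e1 :\: K.
    rewrite eqEcard cardsU1 !inE (negbTE x1r) andbF c4 leqnn andbT.
    by rewrite subUset sub1set !inE x1K x1s setSD.
  by move=> /eqP <-; apply: setUS; apply: subsetDl.
have bK := bad K x1 Ke1 x1s x1r k1 d1.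
(* The transported strict inequality yields [j] outside [K], marked but not loose in [w e1]. *)
have : 0 < #|(mark e1 :\: K) :\: ((loose e1 :\ b) :\: K)|.
  rewrite cardsDS; first by rewrite subn_gt0 c2 c3.
  by apply: setSD; apply: subset_trans (subsetDl _ _) ls1.
rewrite card_gt0 => /set0Pn[j]; rewrite !inE.
case: (boolP (j \in K)) => [|jK]; rewrite ?andbF //= => /andP[jl js].
have jb : j != b by apply: contraNneq jK => ->.
have := gE _ _ _ e1E x1s x1r Ke1 (kernelS (leqnn _) (curE _ e1R) k1) d1.
move=> /subsetP/(_ j); rewrite !inE jK (subsetP ss1 _ js) => /(_ isT).
case/orP=> [/eqP jx|jl']; first by move: x1r; rewrite -jx js.
by move: jl; rewrite jb jl'.
Qed.

(** Sets that are stuck or can be hardened are peeled off and collected, relabelled, in [EA] and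
    [EB]. What remains is stable in the sense required by [stable_flush]. *)
Lemma relabelling_phase (T : finType) (k m v L : nat) (E : {set marked_set T}) :
  layered k m v E -> indep L E -> rigid L E ->
  exists S EA EB : {set marked_set T},
  [/\ S \subset E,
      (forall e x, e \in S -> x \in supp e -> x \notin mark e ->
         exists K : {set T}, [/\ K \subset supp e, kernel L S K e, x \notin K
                 & supp e :\: K \subset x |: loose e]) /\
      (forall e b, e \in S -> b \in loose e ->
         exists (K : {set T}) x, [/\ K \subset supp e, kernel L S K e,
            b \notin K, x \notin mark e & supp e :\: K \subset x |: loose e]),
      layered k m.+1 m.+1 EA /\ indep (4 ^ m.+1 * L) EA,
      [/\ layered k m v.-1 EB, indep (4 ^ m * L) EB, rigid (4 ^ m * L) EB
        & v = 0 -> EB = set0]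
    & (forall e', e' \in EA :|: EB -> exists2 e, e \in E & supp e' = supp e) /\
      forall e, e \in E -> e \in S \/
        exists2 e', e' \in EA :|: EB & supp e' = supp e].
Proof.
move=> lE iE gE.
pose bad (cur : {set marked_set T}) e e' := stuck L cur e e' \/ hardening L cur e e'.
have [S [r [w [SE stS rS]]]] := peeling_order (set0, set0, set0) bad E.
pose cur a := S :|: [set b in E :\: S | r a <= r b].
have curE a : cur a \subset E.
  rewrite subUset SE; apply/subsetP => b; rewrite !inE.
  by move=> /andP[/andP[]].
pose RA := [set e in E :\: S | `[< stuck L (cur e) e (w e) >]].
pose RB := [set e in E :\: S | `[< hardening L (cur e) e (w e) >]].
exists S, (w @: RA), (w @: RB).
have curR e1 e2 : e1 \in E :\: S -> e2 \in E :\: S -> r e1 <= r e2 -> e2 \in cur e1.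
  by move=> _; rewrite !inE => -> ->; rewrite orbT.
have RAE e : e \in RA -> e \in E :\: S by rewrite inE => /andP[].
have RBE e : e \in RB -> e \in E :\: S by rewrite inE => /andP[].
split=> //.
(* If all relevant kernels contained [x] (or [b]), [e] would be bad in [S] itself. Rigidity of [E]
   sharpens the inclusion from the mark to the loose part. *)
- split=> [e x eS xs xr|e b eS bl]; apply: contrapT => nK.
    apply: (stS e (supp e, x |: mark e, x |: mark e) eS); left; exists x; split=> //.
    move=> K Ke kK dK; apply: contraT => xK; exfalso; apply: nK; exists K; split=> //.
    exact: (gE _ _ _ (subsetP SE _ eS) xs xr Ke (kernelS (leqnn _) SE kK)).
  apply: (stS e (supp e, mark e, loose e :\ b) eS); right; exists b; split=> //.
  move=> K x Ke xs xr kK dK; apply: contraT => bK; exfalso; apply: nK.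
  exists K, x; split=> //.
  exact: (gE _ _ _ (subsetP SE _ eS) xs xr Ke (kernelS (leqnn _) SE kK)).
- apply: (@stuck_indep T k m v L E RA r cur w) => //.
  + by apply/subsetP => e /RAE; rewrite inE => /andP[].
  + by move=> e1 e2 /RAE h1 /RAE h2; exact: curR.
  + by move=> e; rewrite inE => /andP[_ /asboolP].
- have [|||lB iB gB] := @hardening_indep T k m v L E RB r cur w lE iE gE _ _ (fun e _ => curE e).
  + by apply/subsetP => e /RBE; rewrite inE => /andP[].
  + by move=> e1 e2 /RBE h1 /RBE h2; exact: curR.
  + by move=> e; rewrite inE => /andP[_ /asboolP].
  split=> // v0; apply/eqP; rewrite -subset0; apply/subsetP => _ /imsetP[e eB ->].
  have eE : e \in E by move: (RBE _ eB); rewrite inE => /andP[].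
  have [_ _ _ _] := lE e eE.
  rewrite v0; move: eB; rewrite inE => /andP[_ /asboolP[b [bl _ _]]] /eqP.
  by rewrite cards_eq0 => /eqP l0; rewrite l0 inE in bl.
split=> [e'|e eE].
  rewrite inE => /orP[] /imsetP[e]; rewrite !inE => /andP[/andP[_ eE] /asboolP].
    by case=> x [_ _ -> _] ->; exists e.
  by case=> b [_ -> _] ->; exists e.
have [eS|eS] := boolP (e \in S); [by left|right].
have [st|ha] := rS e eE eS.
  exists (w e); first by rewrite inE imset_f // !inE eE eS; apply/asboolP.
  by case: st => x [_ _ -> _].
exists (w e); first by rewrite inE orbC imset_f // !inE eE eS; apply/asboolP.
by case: ha => b [_ -> _].
Qed.

(** * Counting independent families *)

(** A branching argument: fix [D], the support minus the mark, and grow [K] from [D]. A proper [K]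
    is no kernel, so some [L] points meet every agreeing set outside [K], and one of them is added.
    After [m] steps [K] is the support. *)
Lemma indep_card (T : finType) (k m L : nat) (E : {set marked_set T}) :
  m <= k -> layered k m m E -> indep L E -> #|E| <= 'C(#|T|, k - m) * L ^ m.
Proof.
move=> mk lE iE.
have lsE e : e \in E -> loose e = mark e.
  move=> eE; have [_ ls _ cs cl] := lE _ eE.
  by apply/eqP; rewrite eqEcard ls cs cl leqnn.
pose f (e : marked_set T) := supp e :\: mark e.
pose V := [set D : {set T} | #|D| == k - m].
have -> : 'C(#|T|, k - m) = #|V| by rewrite card_draws.
apply: (card_le_fibers (f := f)) => [e eE|D].
  by have [se _ cs ct _] := lE _ eE; rewrite inE cardsDS // cs ct.
rewrite inE => /eqP cD.
have stE e : e \in E -> f e = D -> mark e = supp e :\: D.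
  move=> eE <-; have [se _ _ _ _] := lE _ eE.
  by rewrite /f setDDr setDv set0U (setIidPr se).
suff H j (K : {set T}) : #|K| + j = k -> D \subset K ->
    #|[set e in E | (f e == D) && (K \subset supp e)]| <= L ^ j.
  apply: leq_trans (H m D _ (subxx _)); last by rewrite cD subnK.
  apply/subset_leq_card/subsetP => e; rewrite !inE => /andP[-> /eqP fe].
  by rewrite fe eqxx -fe subsetDl.
elim: j K => [|j IH] K.
  rewrite addn0 => cK DK; rewrite expn0; apply/card_le1_eqP => e e'.
  rewrite !inE => /and3P[eE /eqP fe Ke] /and3P[e'E /eqP fe' Ke'].
  have suppK e1 : e1 \in E -> K \subset supp e1 -> supp e1 = K.
    move=> e1E Ke1; have [_ _ cs _ _] := lE _ e1E.
    by apply/esym/eqP; rewrite eqEcard Ke1 cs cK leqnn.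
  have s1 := stE _ eE fe; have s2 := stE _ e'E fe'.
  have l1 := lsE _ eE; have l2 := lsE _ e'E.
  move: s1 s2 l1 l2 (suppK e eE Ke) (suppK e' e'E Ke'); rewrite /supp /mark /loose.
  by case: e {eE fe Ke} => [[F I] N]; case: e' {e'E fe' Ke'} => [[F' I'] N'] /=;
     move=> -> -> -> -> -> ->.
move=> cK DK; set X := [set e in _ | _].
have [->|[e]] := set_0Vmem X; first by rewrite cards0.
rewrite inE => /and3P[eE /eqP fe Ke].
have [Y [YL hY]] : exists Y : {set T}, #|Y| <= L /\ forall e', e' \in E ->
    agree K e e' -> ~~ (supp e' :&: Y \subset K).
  apply: contrapT => nY.
  have /(iE e K eE Ke) : kernel L E K e.
    move=> Y YL; apply: contrapT => ne; apply: nY; exists Y; split=> // e' e'E ag.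
    by apply/negP => s; apply: ne; exists e'.
  rewrite (stE e) // setDS // => /(_ isT) Ks.
  by have [_ _ cs _ _] := lE _ eE; move: cK; rewrite Ks cs; clear; lia.
apply: (@leq_trans #|\bigcup_(y in Y :\: K)
    [set e' in E | (f e' == D) && (y |: K \subset supp e')]|).
  apply/subset_leq_card/subsetP => e'; rewrite inE => /and3P[e'E /eqP fe' Ke'].
  (* Agreement is automatic: on [K], which contains [D], both marks equal [K :\: D]. *)
  have : ~~ (supp e' :&: Y \subset K).
    apply: hY => //; rewrite /agree Ke' !lsE // (stE e) // (stE e') //=.
    by rewrite !setIDAC (setIidPr Ke) (setIidPr Ke') eqxx.
  case/subsetPn => y; rewrite inE => /andP[ys yY] yK.
  apply/bigcupP; exists y; rewrite !inE ?yY ?yK //.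
  by rewrite e'E fe' eqxx subUset sub1set ys Ke'.
apply: leq_trans (_ : #|Y :\: K| * L ^ j <= _); last first.
  rewrite expnS leq_mul2r; apply/orP; right; apply: leq_trans YL.
  exact/subset_leq_card/subsetDl.
apply: card_bigcup_le => y; rewrite inE => /andP[yK _]; apply: IH.
  by rewrite cardsU1 yK add1n addSnnS.
exact: subset_trans DK (subsetUr _ _).
Qed.

(** * Good marks and exceptional sets *)

Definition plain_kernel (T : finType) (L : nat) (F : {set {set T}}) (C : {set T}) :
    Prop :=
  forall Y : {set T}, #|Y| <= L ->
  exists A, [/\ A \in F, C \subset A & A :&: Y \subset C].

Definition good_mark (T : finType) (q t : nat) (F : {set {set T}}) (A I : {set T}) :
    Prop :=
  [/\ I \subset A, #|I| = t &
    forall C : {set T}, I \subset C -> C \subset A -> plain_kernel q F C].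

Lemma subset_of_card (T : finType) (A : {set T}) (c : nat) :
  c <= #|A| -> exists2 B : {set T}, B \subset A & #|B| = c.
Proof.
move=> cA; have : 0 < #|[set B : {set T} | B \subset A & #|B| == c]|.
  by rewrite cards_draws bin_gt0.
rewrite card_gt0 => /set0Pn[B]; rewrite inE => /andP[BA /eqP cB]; by exists B.
Qed.

(* The measure (t + 1 - m)(t + 2) + v drops both when the mark grows (v becomes
   m + 1 <= t + 1) and when its loose part shrinks. *)
Lemma good_mark_or_few_rec (T : finType) (k t q : nat) (F : {set {set T}}) (d : nat) :
  0 < t -> 3 * t <= k ->
  (forall C : {set T}, #|C| = t.-1 -> ~ plain_kernel q F C) ->
  forall m v L (E : {set marked_set T}), (t.+1 - m) * t.+2 + v <= d ->
  m <= t.+1 -> v <= m -> (m = t.+1 -> v = m) -> 2 ^ (3 * t) * q <= L ->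
  layered k m v E -> indep L E -> rigid L E ->
  (forall e, e \in E -> supp e \in F) ->
  exists2 B : {set {set T}},
    #|B| <= 2 ^ d * ('C(#|T|, k - t.+1) * (4 ^ (t.+1 * d) * L) ^ t.+1) &
    forall e, e \in E -> supp e \in B \/ exists I, good_mark q t F (supp e) I.
Proof.
move=> t0 tk nK.
elim: d => [|d IH] m v L E dm mt vm mv qL lE iE gE EF.
all: have [m1|m1] := eqVneq m t.+1.
(* At mark size [t.+1] all sets count as exceptional, and [indep_card] bounds their number. *)
1,3: have vm' := mv m1; subst v m; exists [set supp e | e in E];
  last by move=> e eE; left; apply: imset_f.
1,2: apply: leq_trans (leq_imset_card _ _) _; apply: leq_trans (indep_card _ lE iE) _;
  first by clear -tk t0; lia.
1,2: rewrite -[X in X <= _]mul1n leq_mul ?expn_gt0 // leq_mul2l leq_exp2r //;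
  by rewrite -[X in X <= _]mul1n leq_mul ?expn_gt0 ?orbT.
  by exfalso; clear -dm mt m1; lia.
have {}mt : m <= t by clear -mt m1; lia.
have [S [EA [EB [SE [hA hB] [lA iA] [lB iB gB B0] [supW cov]]]]] := relabelling_phase lE iE gE.
have lS e : e \in S -> loose e \subset mark e /\ mark e \subset supp e.
  by move=> eS; have [] := lE _ (subsetP SE _ eS).
have q1 : q <= L by apply: leq_trans qL; rewrite -[X in X <= _]mul1n leq_mul ?expn_gt0.
have goodS e : e \in S -> exists I, good_mark q t F (supp e) I.
  move=> eS; have eE := subsetP SE _ eS; have [ss ls cs ct cl] := lE _ eE.
  have [/andP[/eqP mt' /eqP v0]|nt] := boolP ((m == t) && (v == 0)).
    have l0 : loose e = set0 by apply/eqP; rewrite -cards_eq0 cl v0.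
    exists (mark e); split=> //; first by rewrite ct mt'.
    move=> C sC Cs Y YL.
    (* With [c0] the full size of [C1], the exchange loses nothing of [C :\: mark e], so [e']
       contains all of [C]. *)
    have [||||e' [C' [e'S C'e' YC' [s1 s2 cC']]]] :=
      @stable_flush T L S e (C :\: mark e) Y #|C :\: mark e| lS hA hB eS.
    - exact: subset_trans (subsetDl _ _) Cs.
    - by rewrite disjoints_subset setDE subsetIr.
    - by rewrite l0 cards0.
    - exact: leq_trans YL q1.
    exists (supp e'); split=> //; first exact/EF/(subsetP SE).
      apply: subset_trans C'e'; apply/subsetP => y yC.
      have [ys|ys] := boolP (y \in mark e).
        by apply: (subsetP s1); rewrite l0 setD0.
      have /eqP e1 : C' :&: (C :\: mark e) == C :\: mark e.
        by rewrite eqEcard subsetIr cC' leqnn.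
      have : y \in C' :&: (C :\: mark e) by rewrite e1 !inE ys.
      by rewrite inE => /andP[].
    apply: subset_trans YC' _; apply: subset_trans s2 _.
    by rewrite subUset subsetDl l0 setD0.
  exfalso.
  (* Here [m - v < t], so [c0] points of [C1] complete the marked points that are not loose to a set
     of size [t.-1]. *)
  pose c0 := t.-1 - (m - v).
  have c0E : c0 + (m - v) = t.-1.
    by rewrite /c0 subnK //; clear -nt mt vm t0; lia.
  have [|C1 C1s cC1] := @subset_of_card T (supp e :\: mark e) (v + c0).
    by rewrite cardsDS // cs ct; clear -c0E tk mt vm t0; lia.
  have /choice[h hP] : forall C : {set T}, exists Y : {set T},
      #|C| = t.-1 -> #|Y| <= q /\
      forall A, A \in F -> C \subset A -> ~~ (A :&: Y \subset C).
    move=> C; have [cC|cC] := eqVneq #|C| t.-1; last first.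
      by exists set0 => cC'; rewrite cC' eqxx in cC.
    apply: contrapT => nY; apply: (nK C cC) => Y YL; apply: contrapT => nA.
    apply: nY; exists Y => _; split=> // A AF CA.
    by apply/negP => s; apply: nA; exists A.
  (* The set [C'] produced by the exchange is not known in advance, so the hitting sets of all
     candidates are avoided at once. They lie in [C1 :|: mark e], of size at most [3 * t], whence
     the factor [2 ^ (3 * t)]. *)
  pose V := [set C in powerset (C1 :|: mark e) | #|C| == t.-1].
  have VL : #|\bigcup_(C in V) h C| <= L.
    apply: leq_trans qL; apply: (@leq_trans (#|V| * q)).
      by apply: card_bigcup_le => C; rewrite inE => /andP[_ /eqP /hP[]].
    rewrite leq_mul2r; apply/orP; right.
    apply: (@leq_trans #|powerset (C1 :|: mark e)|).
      by apply/subset_leq_card/subsetP => C; rewrite inE => /andP[].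
    rewrite card_powerset leq_exp2l //; apply: leq_trans (leq_card_setU _ _) _.
    by rewrite cC1 ct; clear -c0E mt vm t0; lia.
  have [|||e' [C' [e'S C'e' YC' [s1 s2 cC']]]] :=
    @stable_flush T L S e C1 (\bigcup_(C in V) h C) c0 lS hA hB eS _ _ _ VL.
  - exact: subset_trans C1s (subsetDl _ _).
  - by rewrite disjoints_subset; apply: subset_trans C1s _; rewrite setDE subsetIr.
  - by rewrite cl cC1.
  have dC1 : C1 :&: (mark e :\: loose e) = set0.
    apply/eqP; rewrite -subset0; apply/subsetP => y; rewrite !inE.
    case/andP=> /(subsetP C1s); rewrite !inE => /andP[/negbTE ->].
    by rewrite andbF.
  have C'E : C' = (C' :&: C1) :|: (mark e :\: loose e).
    apply/setP => y; rewrite in_setU in_setI; apply/idP/idP.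
      by move=> yC; rewrite yC -in_setU (subsetP s2).
    by case/orP=> [/andP[]//|/(subsetP s1)].
  have c' : #|C'| = t.-1.
    rewrite C'E cardsU -setIA dC1 setI0 cards0 subn0 cC' cardsDS // ct cl.
    exact: c0E.
  have [_ /(_ (supp e'))] := hP C' c'.
  move=> /(_ (EF _ (subsetP SE _ e'S)) C'e') /negP; apply.
  apply: subset_trans YC'; apply: setIS; apply: bigcup_sup.
  rewrite !inE c' eqxx andbT; apply: subset_trans s2 _; apply: setUS.
  exact: subsetDl.
have WF e : e \in EA :|: EB -> supp e \in F.
  by move=> /supW[e' e'E ->]; exact: EF.
have leL a : a <= m.+1 -> 4 ^ a * L <= 4 ^ t.+1 * L.
  by move=> am; rewrite leq_mul2r leq_exp2l // (leq_trans am) ?orbT.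
have qL' a : 2 ^ (3 * t) * q <= 4 ^ a * L.
  by apply: leq_trans qL _; rewrite -[X in X <= _]mul1n leq_mul ?expn_gt0.
(* Either branch multiplies [L] by at most [4 ^ t.+1], absorbed in passing from [d] to [d.+1]; the
   two branches double the power of 2. *)
pose bnd := 'C(#|T|, k - t.+1) * (4 ^ (t.+1 * d.+1) * L) ^ t.+1.
have bndP a : a <= m.+1 ->
    2 ^ d * ('C(#|T|, k - t.+1) * (4 ^ (t.+1 * d) * (4 ^ a * L)) ^ t.+1) <=
    2 ^ d * bnd.
  move=> am; rewrite leq_mul2l leq_mul2l leq_exp2r // mulnS expnD.
  by rewrite [4 ^ t.+1 * _]mulnC -mulnA leq_mul2l leL // !orbT.
have [BA cA hBA] : exists2 B : {set {set T}}, #|B| <= 2 ^ d * bnd &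
    forall e, e \in EA -> supp e \in B \/ exists I, good_mark q t F (supp e) I.
  have [|||B cB hB'] := IH m.+1 m.+1 (4 ^ m.+1 * L) EA _ _ (leqnn _) (fun _ => erefl)
    (qL' _) lA iA (rigid_loose_mark lA).
  - move: dm; rewrite subSS subSn // mulSn; clear -mt; nia.
  - by rewrite ltnS.
  - by move=> e eA; apply: WF; rewrite inE eA.
  by exists B => //; apply: leq_trans cB _; apply: bndP.
have [BB cB hBB] : exists2 B : {set {set T}}, #|B| <= 2 ^ d * bnd &
    forall e, e \in EB -> supp e \in B \/ exists I, good_mark q t F (supp e) I.
  have [v0|v0] := posnP v.
    by exists set0; rewrite ?cards0 // => e; rewrite (B0 v0) inE.
  have [|||||B cB hB'] := IH m v.-1 (4 ^ m * L) EB _ _ _ _ (qL' _) lB iB gB.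
  - by move: dm; clear -v0; lia.
  - exact: leqW.
  - by clear -vm; lia.
  - by move=> mt'; rewrite mt' eqxx in m1.
  - by move=> e eB; apply: WF; rewrite inE eB orbT.
  by exists B => //; apply: leq_trans cB _; apply: bndP.
exists (BA :|: BB).
  apply: leq_trans (leq_card_setU _ _) _.
  by rewrite expnS -mulnA mul2n -addnn leq_add.
move=> e eE; have [eS|[e' e'W <-]] := cov e eE; first by right; exact: goodS.
move: e'W; rewrite inE => /orP[eA|eB].
  by have [h|h] := hBA _ eA; [left; rewrite inE h|right].
by have [h|h] := hBB _ eB; [left; rewrite inE h orbT|right].
Qed.

Theorem good_mark_or_few (T : finType) (k t q : nat) (F : {set {set T}}) :
  0 < t -> 3 * t <= k -> uniform k F ->
  (forall C : {set T}, #|C| = t.-1 -> ~ plain_kernel q F C) ->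
  let d := t.+1 * t.+2 in
  exists2 B : {set {set T}},
    #|B| <= 2 ^ d * ('C(#|T|, k - t.+1) *
      (4 ^ (t.+1 * d) * (2 ^ (3 * t) * q)) ^ t.+1) &
    forall A, A \in F -> A \in B \/ exists I, good_mark q t F A I.
Proof.
move=> t0 tk uF nK d.
(* The recursion starts from empty marks, where independence is trivial and the measure is
   [t.+1 * t.+2]. *)
pose E : {set marked_set T} := [set (A, set0, set0) | A in F].
have EP e : e \in E -> [/\ supp e \in F, mark e = set0 & loose e = set0].
  by case/imsetP=> A AF ->.
have lE : layered k 0 0 E.
  by move=> e /EP[eF -> ->]; rewrite !sub0set cards0 uF.
have [|||||||||B cB hB] := @good_mark_or_few_rec T k t q F d t0 tk nK 0 0 (2 ^ (3 * t) * q) E.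
- by rewrite subn0 addn0.
- by [].
- by [].
- by [].
- by [].
- by [].
- move=> e K eE Ke _; have [_ -> _] := EP _ eE.
  by rewrite subset0 setD_eq0 => sK; apply/eqP; rewrite eqEsubset Ke.
- exact: rigid_loose_mark lE.
- by move=> e /EP[].
by exists B => // A AF; apply: (hB (A, set0, set0)); apply: imset_f.
Qed.

(** * Sunflowers from kernels and the combinatorial bound *)

(** Kernels are replaced one by one by members of [F] that avoid, outside their kernel, the at most
    [s * k] points of the current sets; pairwise intersections stay [C]. As [#|C| < k], the members
    are distinct. *)
Lemma sunflower_of_kernels (T : finType) (s k : nat) (F : {set {set T}})
    (K : 'I_s -> {set T}) (C : {set T}) :
  1 < s -> uniform k F -> #|C| < k -> (forall i, plain_kernel (s * k) F (K i)) ->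
  (forall i j, i != j -> K i :&: K j = C) ->
  exists S : {set {set T}}, [/\ S \subset F, sunflower s S & core S = C].
Proof.
move=> s1 uF Ck uK KC.
have Kk i : #|K i| <= k.
  have [|A [AF KA _]] := uK i set0; first by rewrite cards0.
  by rewrite -(uF A AF) subset_leq_card.
suff H n : n <= s -> exists G : 'I_s -> {set T},
    [/\ forall i : 'I_s, if i < n then (G i \in F) else (G i == K i),
        forall i, #|G i| <= k & forall i j, i != j -> G i :&: G j = C].
  have [G [GF _ GC]] := H s (leqnn s).
  have {}GF i : G i \in F by have := GF i; rewrite ltn_ord.
  have injG : injective G.
    move=> i j Gij; apply/eqP; apply: contraT => /GC.
    by rewrite -Gij setIid => GiC; move: Ck; rewrite -GiC (uF _ (GF i)) ltnn.
  have s0 : 0 < s by apply: ltnW.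
  have coreC : core [set G i | i in [set: 'I_s]] = C.
    pose i0 := Ordinal s0; pose i1 := Ordinal s1.
    have i01 : i0 != i1 by [].
    apply/eqP; rewrite eqEsubset; apply/andP; split.
      rewrite -(GC _ _ i01) subsetI.
      by rewrite !bigcap_inf ?imset_f ?inE.
    apply/bigcapsP => _ /imsetP[i _ ->].
    have [j ij] : exists j, i != j.
      by case: (eqVneq i i0) => [->|]; [exists i1|exists i0].
    by rewrite -(GC _ _ ij) subsetIl.
  exists [set G i | i in [set: 'I_s]]; split=> //.
    by apply/subsetP => _ /imsetP[i _ ->].
  split; first by rewrite card_imset // cardsT card_ord.
  move=> _ _ /imsetP[i _ ->] /imsetP[j _ ->] Gij; rewrite coreC.
  by apply: GC; apply: contraNneq Gij => ->.
elim: n => [|n IH] ns; first by exists K; split=> // i; rewrite ltn0.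
have [G [GF Gk GC]] := IH (ltnW ns).
pose i0 := Ordinal ns.
have GK : G i0 = K i0 by have := GF i0; rewrite ltnn => /eqP.
have [|A [AF KA AY]] := uK i0 (\bigcup_(j in [set: 'I_s]) G j).
  by apply: leq_trans (card_bigcup_le (fun i _ => Gk i)) _; rewrite cardsT card_ord.
have AC j : i0 != j -> A :&: G j = C.
  move=> ij; rewrite -(GC _ _ ij) GK; apply/setP => y; rewrite !inE.
  case: (boolP (y \in G j)) => yG; rewrite ?andbF // !andbT.
  apply/idP/idP => [yA|/(subsetP KA)//]; apply: (subsetP AY); rewrite inE yA.
  by apply/bigcupP; exists j.
exists (fun i => if i == i0 then A else G i); split.
- move=> i; case: eqVneq => [->|ii]; first by rewrite /= ltnSn.
  have := GF i; suff -> : (i < n) = (i < n.+1) by [].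
  have : (i : nat) != n by apply: contraNneq ii => e; apply/eqP/val_inj.
  by rewrite [in RHS]ltnS [in RHS]leq_eqVlt => /negbTE ->.
- by move=> i; case: eqVneq => // _; rewrite (uF _ AF).
move=> i j ij; case: eqVneq => [ei|_]; case: eqVneq => [ej|_]; last exact: GC.
- by rewrite ei ej eqxx in ij.
- by apply: AC; rewrite -ei.
by rewrite setIC; apply: AC; rewrite -ej eq_sym.
Qed.

(** Sets with the same unmarked part [D] are told apart by their marks. A sunflower of marks,
    enlarged by common points of [D], would give kernels with pairwise intersection of size
    [t.-1]. *)
Lemma good_mark_card (n s t k : nat) (F G : {set {set 'I_n}}) :
  1 < s -> 0 < t -> 2 * t <= k -> uniform k F ->
  sunflower_free_core s t.-1 F -> G \subset F ->
  (forall A, A \in G -> exists I, good_mark (s * k) t F A I) ->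
  #|G| <= 'C(n, k - t) * phi s t.
Proof.
move=> s1 t0 tk uF fF GF gG.
have /choice[h hP] : forall A, exists I, A \in G -> good_mark (s * k) t F A I.
  move=> A; have [/gG[I gI]|_] := boolP (A \in G); first by exists I.
  by exists set0.
pose V := [set D : {set 'I_n} | #|D| == k - t].
have -> : 'C(n, k - t) = #|V| by rewrite card_draws card_ord.
apply: (card_le_fibers (f := fun A => A :\: h A)) => [A AG|D].
  by have [IA cI _] := hP A AG; rewrite inE cardsDS // cI (uF _ (subsetP GF _ AG)).
rewrite inE => /eqP cD; set P := [set A in G | _].
have PP A : A \in P -> [/\ A \in G, A :\: h A = D & A = D :|: h A].
  rewrite inE => /andP[AG /eqP AD]; split=> //; have [IA _ _] := hP A AG.
  by rewrite -AD setUC; have := setID A (h A); rewrite (setIidPr IA).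
have hinj : {in P &, injective h}.
  by move=> A A' /PP[_ _ eA] /PP[_ _ eA'] hh; rewrite eA eA' hh.
rewrite -(card_in_imset hinj).
have [_] := phiP t (ltnW s1); apply; exists n, (h @: P); split=> //.
  by move=> _ /imsetP[A /PP[AG _ _] ->]; have [_ cI _] := hP A AG.
case=> S [SP [cS SC]]; apply: fF.
have SB B : B \in S -> [/\ #|B| = t, [disjoint D & B] &
    forall C : {set 'I_n}, B \subset C -> C \subset D :|: B -> plain_kernel (s * k) F C].
  move=> /(subsetP SP)/imsetP[A /PP[AG AD eA] ->]; have [_ cI uk] := hP A AG.
  split=> //; first by rewrite -AD disjoints_subset setDE subsetIr.
  by move=> C IC CA; apply: uk; rewrite // eA.
pose b (i : 'I_s) := nth set0 (enum S) i.
have bS i : b i \in S by rewrite -mem_enum mem_nth // -cardE cS.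
have binj i j : i != j -> b i != b j.
  by move=> ij; rewrite nth_uniq ?enum_uniq // -?cardE ?cS.
have cC : #|core S| < t.
  have bb : b (Ordinal (ltnW s1)) != b (Ordinal s1) by apply: binj.
  have [c1 _ _] := SB _ (bS (Ordinal (ltnW s1))).
  have [c2 _ _] := SB _ (bS (Ordinal s1)).
  rewrite -(SC _ _ (bS _) (bS _) bb) -[X in _ < X]c1; apply: proper_card.
  rewrite properE subsetIl /=; apply: contra bb => sub.
  rewrite eqEcard c1 c2 leqnn andbT; apply: subset_trans sub _; exact: subsetIr.
(* [D] has [k - t >= t] points, enough to pad the core to size exactly [t.-1]. *)
have [|X XD cX] := @subset_of_card _ D (t.-1 - #|core S|).
  by rewrite cD; clear -tk; lia.
have dX i : [disjoint X & b i] by have [_ d _] := SB _ (bS i); apply: disjointWl d.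
have i0 : 'I_s by exists 0; apply: ltnW.
have cCX : #|core S :|: X| = t.-1.
  have [_ dB _] := SB _ (bS i0).
  have CB : core S \subset b i0 by apply: bigcap_inf.
  rewrite cardsU (_ : core S :&: X = set0) ?cards0 ?subn0 ?cX.
    by rewrite subnKC //; clear -cC; lia.
  apply: disjoint_setI0; rewrite disjoint_sym.
  exact: disjointWr CB (disjointWl XD dB).
have [|i|i j ij|S' [S'F S's S'c]] := @sunflower_of_kernels _ s k F
    (fun i => b i :|: X) (core S :|: X) s1 uF.
- by rewrite cCX; clear -tk t0; lia.
- have [_ _ uk] := SB _ (bS i); apply: uk; first exact: subsetUl.
  by rewrite setUC setSU.
- by rewrite -setUIl SC ?bS ?binj.
by exists S'; split=> //; rewrite S'c.
Qed.

Theorem sunflower_free_core_card (n s t k d : nat) (F : {set {set 'I_n}}) :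
  1 < s -> 0 < t -> 3 * t <= k -> uniform k F ->
  sunflower_free_core s t.-1 F ->
  d = t.+1 * t.+2 ->
  #|F| <= 'C(n, k - t) * phi s t +
    2 ^ d * ('C(n, k - t.+1) *
      (4 ^ (t.+1 * d) * (2 ^ (3 * t) * (s * k))) ^ t.+1).
Proof.
move=> s1 t0 tk uF fF ->.
have [|B cB hB] := @good_mark_or_few _ k t (s * k) F t0 tk uF.
  move=> C cC uC; apply: fF.
  (* One kernel of size [t.-1], repeated [s] times, already gives the forbidden sunflower. *)
  have [||S [SF Ss Sc]] := @sunflower_of_kernels _ s k F (fun=> C) C s1 uF _ (fun=> uC).
  - by rewrite cC; clear -tk t0; lia.
  - by move=> *; rewrite setIid.
  by exists S; split=> //; rewrite Sc.
rewrite card_ord in cB.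
rewrite -(cardsID B F) addnC leq_add //.
  apply: (@good_mark_card n s t k F) => //; first by clear -tk; lia.
    exact: subsetDl.
  move=> A; rewrite inE => /andP[/negbTE AB AF].
  by have [|] := hB A AF; rewrite ?AB.
exact: leq_trans (subset_leq_card (subsetIr _ _)) cB.
Qed.

(** * Binomial and error estimates *)

(** Pascal's rule [t] times, each discarded term being at most ['C(n, j)]. *)
Lemma bin_sub_upper (n t j : nat) :
  'C(n, j.+1) <= 'C(n - t, j.+1) + t * 'C(n, j).
Proof.
elim: t => [|t IH]; first by rewrite subn0 mul0n addn0.
apply: leq_trans IH _; rewrite mulSn addnA leq_add2r subnS.
case: (n - t) (leq_subr t n) => [|m] mn; first by rewrite leq_addr.
by rewrite binS leq_add2l /= leq_bin2l // ltnW.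
Qed.

(** Lowering the upper index by one at most halves the coefficient while that index is at least
    [2 * j]. *)
Lemma bin_le_exp2_mul (n t j : nat) :
  2 * (j + t) <= n -> 'C(n, j) <= 2 ^ t * 'C(n - t, j).
Proof.
elim: t => [|t IH] jn; first by rewrite subn0 mul1n.
apply: leq_trans (IH _) _; first by lia.
rewrite expnS [2 * _]mulnC -mulnA leq_mul2l subnS; apply/orP; right.
have jm : 2 * j < n - t by lia.
case: (n - t) jm => // m jm /=.
rewrite -(leq_pmul2l (m := m.+1 - j)); last by lia.
by rewrite -mul_bin_down /= mulnA leq_mul2r; apply/orP; right; lia.
Qed.

(** With [j = k - t - 1] this is the saving of order [n / k] that makes the exceptional sets
    negligible. *)
Lemma mul_bin_le (n t j : nat) : 2 * (j + t) <= n ->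
  n * 'C(n, j) <= 2 ^ t.+1 * j.+1 * 'C(n - t, j.+1).
Proof.
move=> jn; rewrite -mulnA mul_bin_left.
apply: (@leq_trans (n * (2 ^ t * 'C(n - t, j)))).
  by rewrite leq_mul2l bin_le_exp2_mul ?orbT.
rewrite expnS !mulnA leq_mul2r; apply/orP; right.
rewrite -mulnA [n * _]mulnC [2 * _]mulnCA leq_mul2l; apply/orP; right; lia.
Qed.

Lemma phi_le (s t : nat) : 0 < s -> phi s t <= t`! * s ^ t.
Proof.
move=> s0; have [[N [G [uG fG <-]]] _] := phiP t s0.
apply: leq_trans (erdos_rado s0 uG fG) _; rewrite leq_mul2l; apply/orP; right.
by case: t {G uG fG N} => // t; rewrite leq_exp2r // leq_pred.
Qed.

Definition depth (t : nat) : nat := t.+1 * t.+2.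

Definition blowup (t : nat) : nat := 4 ^ (t.+1 * depth t) * 2 ^ (3 * t).

Definition error_const (t : nat) : nat :=
  (t`! * t + 2 ^ depth t * blowup t ^ t.+1) * 2 ^ t.+1.

(** The first summand pays for replacing ['C(n, k - t)] by ['C(n - t, k - t)], the second for the
    exceptional sets. *)
Definition error_coef (s t k : nat) : nat :=
  phi s t * t + 2 ^ depth t * (blowup t * (s * k)) ^ t.+1.

Lemma error_coef_le (s t k : nat) : 0 < s -> 0 < t -> 0 < k ->
  error_coef s t k * (2 ^ t.+1 * k) <=
  error_const t * (s ^ (2 * t) * k ^ (3 * t)).
Proof.
move=> s0 t0 k0.
have h1 : phi s t * t <= t`! * t * (s * k) ^ (2 * t).
  rewrite mulnAC leq_mul2r; apply/orP; right.
  apply: leq_trans (phi_le t s0) _; rewrite leq_mul2l; apply/orP; right.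
  apply: (@leq_trans ((s * k) ^ t)); first by rewrite leq_exp2r // leq_pmulr.
  by rewrite leq_pexp2l ?muln_gt0 ?s0 // leq_pmull.
have h2 : (blowup t * (s * k)) ^ t.+1 <= blowup t ^ t.+1 * (s * k) ^ (2 * t).
  rewrite expnMn leq_mul2l leq_pexp2l ?muln_gt0 ?s0 ?orbT //; lia.
have h3 : error_coef s t k <=
    (t`! * t + 2 ^ depth t * blowup t ^ t.+1) * (s * k) ^ (2 * t).
  by rewrite mulnDl leq_add // -mulnA leq_mul2l h2 orbT.
apply: leq_trans (leq_mul h3 (leqnn _)) _.
rewrite /error_const -!mulnA leq_mul2l; apply/orP; right.
rewrite mulnCA leq_mul2l; apply/orP; right.
rewrite expnMn -mulnA leq_mul2l; apply/orP; right.
by rewrite -expnSr leq_pexp2l //; lia.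
Qed.

(** Cubing avoids the exponent 1/3. By [error_coef_le] the cube is at most [error_const t ^ 3 * s ^
    (6 * t) * k ^ (9 * t)]: one factor [n] absorbs the power of [k], the other the rest. *)
Lemma error_cube (s t n k G : nat) : 0 < s -> 0 < t -> 0 < k ->
  error_const t ^ 3 <= G -> k ^ (20 * t) <= n -> s ^ (40 * t) * G <= n ->
  (error_coef s t k * (2 ^ t.+1 * k)) ^ 3 <= n ^ 2.
Proof.
move=> s0 t0 k0 cG kn sn.
apply: (@leq_trans ((error_const t * (s ^ (2 * t) * k ^ (3 * t))) ^ 3)).
  by rewrite leq_exp2r // error_coef_le.
move: (error_const t) cG => c cG; apply: leq_trans (leq_mul kn sn).
rewrite !expnMn -!expnM mulnA [X in _ <= X]mulnC; apply: leq_mul.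
  by rewrite mulnC; apply: leq_mul => //; rewrite leq_pexp2l //; lia.
by rewrite leq_pexp2l //; lia.
Qed.

Lemma sunflower_free_core_bound (n s t k : nat) (F : {set {set 'I_n}}) :
  1 < s -> 0 < t -> 3 * t <= k -> 2 * k <= n -> uniform k F ->
  sunflower_free_core s t.-1 F ->
  exists2 e, #|F| <= phi s t * 'C(n - t, k - t) + e &
    n * e <= error_coef s t k * (2 ^ t.+1 * k) * 'C(n - t, k - t).
Proof.
move=> s1 t0 tk kn uF fF.
exists (error_coef s t k * 'C(n, k - t.+1)).
  apply: leq_trans (sunflower_free_core_card s1 t0 tk uF fF (erefl (depth t))) _.
  rewrite /error_coef [4 ^ _ * (_ * _)]mulnA -/(blowup t) ['C(n, k - t.+1) * _]mulnC.
  rewrite [2 ^ _ * (_ * _)]mulnA mulnDl addnA leq_add2r mulnC -mulnA -mulnDr.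
  rewrite leq_mul2l.
  apply/orP; right; have -> : k - t = (k - t.+1).+1 by lia.
  exact: bin_sub_upper.
rewrite mulnCA -!mulnA leq_mul2l; apply/orP; right.
apply: leq_trans (mul_bin_le (t := t) _) _; first by lia.
have -> : (k - t.+1).+1 = k - t by lia.
by rewrite -mulnA leq_mul2l leq_mul2r leq_subr !orbT.
Qed.

(** * Passage to real exponents *)

Local Open Scope ring_scope.

Lemma powR_inv_cube (R : realType) (n : nat) : (0 < n)%N ->
  ((n%:R : R) `^ (- (1 / 3))) ^+ 3 = n%:R^-1.
Proof.
move=> n0; rewrite -powR_mulrn ?powR_ge0 // -powRrM mulNr -mulrA mulVf ?pnatr_eq0 //.
by rewrite mulr1 powR_inv1 ?ler0n.
Qed.

Lemma le_powR_inv_cube (R : realType) (n W : nat) : (0 < n)%N ->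
  (W ^ 3 <= n ^ 2)%N -> (W%:R : R) <= n%:R * n%:R `^ (- (1 / 3)).
Proof.
move=> n0 Wn; rewrite -(ler_pXn2r (n := 3)) ?nnegrE ?mulr_ge0 ?powR_ge0 ?ler0n //.
rewrite exprMn powR_inv_cube // [n%:R ^+ 3]exprSr -mulrA mulfV ?pnatr_eq0 -?lt0n //.
by rewrite mulr1 -!natrX ler_nat.
Qed.

Theorem theorem11 (R : realType) :
  exists g0 : nat -> R,
    (forall t : nat, (0 < t)%N ->
       (2 ^+ 20 * t%:R ^+ 6) ^+ (20 * t) <= g0 t) /\
    (forall s t n k : nat,
       (1 < s)%N -> (0 < t)%N -> (0 < n)%N -> (0 < k)%N ->
       (k ^ (20 * t) <= n)%N ->
       s%:R ^+ (40 * t) * g0 t <= n%:R ->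
       (5 * t <= k)%N ->
       forall F : {set {set 'I_n}},
         uniform k F ->
         sunflower_free_core s (t - 1) F ->
         (#|F|%:R : R) <= (phi s t)%:R * 'C(n - t, k - t)%:R
                    + (n%:R : R) `^ (- (1 / 3)) * 'C(n - t, k - t)%:R).
Proof.
(* The first summand meets the required lower bound, the second is what [error_cube] asks for. *)
pose G (t : nat) : nat := ((2 ^ 20 * t ^ 6) ^ (20 * t) + error_const t ^ 3)%N.
exists (fun t => (G t)%:R); split=> [t t0|s t n k s1 t0 n0 k0 kn].
  by rewrite -!natrX -natrM -natrX ler_nat leq_addr.
rewrite -natrX -natrM ler_nat => sn tk F uF; rewrite subn1 => fF.
have k2n : (2 * k <= n)%N.
  apply: leq_trans kn; apply: (@leq_trans (k ^ 2)).
    by rewrite -mulnn leq_mul2r; apply/orP; right; clear -tk t0; lia.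
  by rewrite leq_pexp2l //; clear -t0; lia.
have [|e Fe ne] := @sunflower_free_core_bound n s t k F s1 t0 _ k2n uF fF.
  by clear -tk; lia.
apply: le_trans (_ : (phi s t * 'C(n - t, k - t) + e)%:R <= _).
  by rewrite ler_nat.
(* The main terms cancel, and multiplying by [n] reduces the claim to a coefficient of at most
   [n ^ (2 / 3)]. *)
rewrite natrD natrM lerD2l -(ler_pM2l (x := n%:R)) ?ltr0n // mulrA.
have Wn := error_cube (ltnW s1) t0 k0 (leq_addl _ _) kn sn.
apply: le_trans (ler_wpM2r (ler0n _ _) (le_powR_inv_cube R n0 Wn)).
by rewrite -!natrM ler_nat.
Qed.
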